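(* Let $f:\mathbb{R}^n\to\mathbb{R}$ be strongly convex and twice differentiable with constants $0<\beta_1<\beta_2$ such that $\beta_1 I\preceq \nabla^2 f(x^\star+t(x-x^\star))\preceq \beta_2 I$ for all $x\in\mathbb{R}^n$, $t\in[0,1]$, where $x^\star$ is the minimizer of $f$ subject to $Cx+d=0$; let $C\in\mathbb{R}^{m\times n}$ be of full rank, $d\in\mathbb{R}^m$, and $0<\alpha_1\le\alpha_2$ with $\alpha_1 I\preceq CC^\top\preceq\alpha_2 I$. Let $\epsilon\in\left(0,1-\frac{\alpha_1}{8\alpha_2}\right)$ and let $$K_p=\epsilon\,\frac{2K_i}{\beta_2},\qquad K_i>\frac1\epsilon\,\frac{\beta_1\beta_2}{8\alpha_2}.$$ Then, for every $\eta>0$, $\mu>\mu_{PDGD}$, where $$\mu=\min\left\{K_p\alpha_1,\;2\beta_1-\frac{K_p}{K_i}\beta_1\beta_2\right\},\qquad \mu_{PDGD}=\min\left\{\frac{\eta\alpha_1}{4\beta_2},\;\frac{\alpha_1\beta_1}{4\alpha_2}\right\};$$ that is, the exponential convergence rate $\frac12\mu$ guaranteed for PI-CMO is faster than the exponential convergence rate $\frac12\mu_{PDGD}$ established for PDGD.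
   Context: The problem is $\min_{x\in\mathbb{R}^n}f(x)$ subject to $Cx+d=0$. For symmetric matrices, $M\preceq N$ means that $N-M$ is positive semidefinite. PI-CMO with gains $K_p,K_i>0$ is the dynamics $\dot x=-\nabla f(x)-C^\top\lambda$, $\dot\lambda=-K_pC[\nabla f(x)+C^\top\lambda]+K_i(Cx+d)$; when $K_p<2K_i/\beta_2$ its guaranteed global exponential convergence rate is $\frac12\mu$ with $\mu$ as in the claim. PDGD (primal-dual gradient dynamics) with parameter $\eta>0$ is the dynamics $\dot x=-\nabla f(x)-C^\top\lambda$, $\dot\lambda=\eta(Cx+d)$; the global exponential convergence rate established for it in the literature (Qu and Li) is $\frac12\mu_{PDGD}$ with $\mu_{PDGD}$ as in the claim. *)

(* Defs.v *)
From HB Require Import structures.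
From mathcomp Require Export all_boot all_order all_algebra.
From mathcomp Require Export all_classical all_reals all_analysis.

Set Implicit Arguments.
Unset Strict Implicit.
Unset Printing Implicit Defensive.

Export Order.TTheory GRing.Theory Num.Theory.
Export numFieldNormedType.Exports.

Local Open Scope ring_scope.

Definition psd (R : realType) (n : nat) (M : 'M[R]_n) : Prop :=
  M^T = M /\ forall v : 'cV[R]_n, 0 <= (v^T *m M *m v) 0 0.

(* Symmetry is required of the difference only, so that the order applies to
   a Hessian without a preliminary proof that it is symmetric. *)
Definition loewner_le (R : realType) (n : nat) (M N : 'M[R]_n) : Prop :=
  psd (N - M).

Definition sqnorm2 (R : realType) (n : nat) (v : 'cV[R]_n) : R :=
  (v^T *m v) 0 0.

Definition gradient (R : realType) (n : nat) (f : 'cV[R]_n -> R)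
    (x : 'cV[R]_n) : 'cV[R]_n :=
  \col_i 'D_(delta_mx i 0) f x.

Definition hessian (R : realType) (n : nat) (f : 'cV[R]_n -> R)
    (x : 'cV[R]_n) : 'M[R]_n :=
  \matrix_(i, j) 'D_(delta_mx j 0) (fun y => gradient f y i 0) x.

(* Both derivatives are total (Frechet) derivatives; the sup norm that the
   library puts on matrices induces the same notion as the Euclidean norm. *)
Definition twice_differentiable (R : realType) (n : nat)
    (f : 'cV[R]_n -> R) : Prop :=
  (forall x, differentiable f x) /\ (forall x, differentiable (gradient f) x).

(* The norm in the strong convexity inequality is Euclidean, hence sqnorm2
   and not the sup norm of the library. *)
Definition strongly_convex (R : realType) (n : nat)
    (f : 'cV[R]_n -> R) : Prop :=
  exists2 c : R, 0 < c & forall (x y : 'cV[R]_n) (t : R), 0 <= t <= 1 ->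
    f (t *: x + (1 - t) *: y) <=
      t * f x + (1 - t) * f y - c / 2 * t * (1 - t) * sqnorm2 (x - y).

Definition constrained_minimizer (R : realType) (m n : nat)
    (f : 'cV[R]_n -> R) (C : 'M[R]_(m, n)) (d : 'cV[R]_m)
    (xstar : 'cV[R]_n) : Prop :=
  C *m xstar + d = 0 /\ forall x, C *m x + d = 0 -> f xstar <= f x.

(* Half of pi_cmo_mu is the global exponential convergence rate guaranteed,
   when Kp < 2 Ki / beta2, for the dynamics
     x' = - grad f(x) - C^T l,
     l' = - Kp C (grad f(x) + C^T l) + Ki (C x + d). *)
Definition pi_cmo_mu (R : realType) (Kp Ki alpha1 beta1 beta2 : R) : R :=
  Num.min (Kp * alpha1) (2 * beta1 - Kp / Ki * beta1 * beta2).

Definition pi_cmo_rate (R : realType) (Kp Ki alpha1 beta1 beta2 : R) : R :=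
  1 / 2 * pi_cmo_mu Kp Ki alpha1 beta1 beta2.

(* Half of pdgd_mu is the global exponential convergence rate established by
   Qu and Li for the primal-dual gradient dynamics
     x' = - grad f(x) - C^T l,   l' = eta (C x + d). *)
Definition pdgd_mu (R : realType) (eta alpha1 alpha2 beta1 beta2 : R) : R :=
  Num.min (eta * alpha1 / (4 * beta2)) (alpha1 * beta1 / (4 * alpha2)).

Definition pdgd_rate (R : realType) (eta alpha1 alpha2 beta1 beta2 : R) : R :=
  1 / 2 * pdgd_mu eta alpha1 alpha2 beta1 beta2.

(* Main.v *)
Require Import Defs.
From mathcomp Require Import ring lra.

(* Both entries of the minimum defining mu exceed alpha1 beta1 / (4 alpha2),
   the entry of mu_PDGD that does not depend on eta: the lower bound on Ki gives
   this for the first entry, Kp alpha1 = 2 epsilon Ki alpha1 / beta2, and the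
   upper bound on epsilon gives it for the second, 2 beta1 (1 - epsilon). *)

Local Open Scope ring_scope.

Theorem corollary1 (R : realType) (m n : nat)
    (f : 'cV[R]_n -> R) (C : 'M[R]_(m, n)) (d : 'cV[R]_m) (xstar : 'cV[R]_n)
    (alpha1 alpha2 beta1 beta2 epsilon Kp Ki : R)
    (hconv : strongly_convex f)
    (hdiff : twice_differentiable f)
    (hxstar : constrained_minimizer f C d xstar)
    (hbeta1 : 0 < beta1) (hbeta12 : beta1 < beta2)
    (hhess : forall (x : 'cV[R]_n) (t : R), 0 <= t <= 1 ->
       loewner_le beta1%:M (hessian f (xstar + t *: (x - xstar))) /\
       loewner_le (hessian f (xstar + t *: (x - xstar))) beta2%:M)
    (hrank : \rank C = minn m n)
    (halpha1 : 0 < alpha1) (halpha12 : alpha1 <= alpha2)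
    (hCC : loewner_le alpha1%:M (C *m C^T) /\
           loewner_le (C *m C^T) alpha2%:M)
    (hepsilon : 0 < epsilon < 1 - alpha1 / (8 * alpha2))
    (hKp0 : 0 < Kp) (hKi0 : 0 < Ki)
    (hKp : Kp = epsilon * (2 * Ki / beta2))
    (hKi : 1 / epsilon * (beta1 * beta2 / (8 * alpha2)) < Ki) :
  forall eta : R, 0 < eta ->
    pdgd_mu eta alpha1 alpha2 beta1 beta2
      < pi_cmo_mu Kp Ki alpha1 beta1 beta2 /\
    pdgd_rate eta alpha1 alpha2 beta1 beta2
      < pi_cmo_rate Kp Ki alpha1 beta1 beta2.
Proof.
move=> eta _.
have hbeta2 : 0 < beta2 := lt_trans hbeta1 hbeta12.
have halpha2 : 0 < alpha2 := lt_le_trans halpha1 halpha12.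
have /andP[heps0 heps1] := hepsilon.
have hfst : alpha1 * beta1 / (4 * alpha2) < Kp * alpha1.
  (* Both sides are written with the positive factor [2 * epsilon * alpha1 / beta2]; cancelling it
     leaves exactly [hKi]. *)
  have -> : alpha1 * beta1 / (4 * alpha2) =
      2 * epsilon * alpha1 / beta2 *
        (1 / epsilon * (beta1 * beta2 / (8 * alpha2))).
    by field; rewrite !gt_eqF.
  have -> : Kp * alpha1 = 2 * epsilon * alpha1 / beta2 * Ki.
    by rewrite hKp; field; rewrite gt_eqF.
  by rewrite ltr_pM2l // divr_gt0 // !mulr_gt0.
have hsnd : alpha1 * beta1 / (4 * alpha2) < 2 * beta1 - Kp / Ki * beta1 * beta2.
  have -> : alpha1 * beta1 / (4 * alpha2) =
      2 * beta1 * (alpha1 / (8 * alpha2)).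
    by field; rewrite gt_eqF.
  (* By [hKp] the ratio [Kp / Ki] is [2 * epsilon / beta2], so [Ki] and [beta2] cancel. Dividing by
     [2 * beta1] then leaves [heps1] rearranged. *)
  have -> : 2 * beta1 - Kp / Ki * beta1 * beta2 = 2 * beta1 * (1 - epsilon).
    by rewrite hKp; field; rewrite !gt_eqF.
  by rewrite ltr_pM2l ?mulr_gt0 //; lra.
have hmu : pdgd_mu eta alpha1 alpha2 beta1 beta2
    < pi_cmo_mu Kp Ki alpha1 beta1 beta2.
  (* A minimum is below a bound once one entry is, so the right entry settles every [eta] at once;
     the other minimum needs both [hfst] and [hsnd]. *)
  by rewrite /pdgd_mu /pi_cmo_mu gt_min; apply/orP; right; rewrite lt_min hfst.
by split=> //; rewrite /pdgd_rate /pi_cmo_rate ltr_pM2l // divr_gt0.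
Qed.
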